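(* Let $\mathsf{M}$ be a simple matroid on $[n]$ without singleton components, $K$ a field, $E=K\langle e_1,\dots,e_n\rangle$ and $J$ the Orlik–Solomon ideal of $\mathsf{M}$. If $J$ has linear relations, then $\mathsf{M}$ is connected.
   Context: A matroid on $[n]$ is a nonempty family of subsets of $[n]$ (independent sets) containing $\emptyset$, closed under subsets, satisfying the exchange axiom; other subsets are dependent, minimal dependent sets are circuits. A loop is an $i$ with $\{i\}$ dependent; $i,j$ are parallel if $\{i,j\}$ is a circuit; $\mathsf{M}$ is simple if it has no loops and no pair of parallel elements. The connected components are the equivalence classes of $x\sim y$ iff $x=y$ or some circuit contains both; a singleton component is a component with one element; $\mathsf{M}$ is connected if it has exactly one component. $E$ is the standard graded exterior algebra; for $S=\{i_0<\dots<i_m\}$, $e_S=e_{i_0}\wedge\dots\wedge e_{i_m}$ and $\partial e_S=\sum_{j=0}^m(-1)^je_{S\setminus\{i_j\}}$; the Orlik–Solomon ideal is $J=(\partial e_S:S\text{ dependent})$. A graded $E$-module has linear relations if it is generated in a single degree $m$ and its first syzygy module (in a minimal graded free presentation) is generated in degree $m+1$, i.e. $\dim_K\operatorname{Tor}^E_0(K,J)_j=0$ for $j\ne m$ and $\dim_K\operatorname{Tor}^E_1(K,J)_j=0$ for $j\neq m+1$. *)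

(* Defs.v *)
From HB Require Import structures.
From mathcomp Require Import all_boot all_order all_algebra.

Set Implicit Arguments.
Unset Strict Implicit.
Unset Printing Implicit Defensive.

Import GRing.Theory.

Local Open Scope ring_scope.

(* The ground set [n] is 'I_n, i.e. {0, ..., n-1} with its usual order.       *)

Record matroid (n : nat) := Matroid {
  indep : {set {set 'I_n}};
  indep0 : set0 \in indep;
  indepS : forall A B : {set 'I_n}, B \in indep -> A \subset B -> A \in indep;
  indep_exchange : forall A B : {set 'I_n},
    A \in indep -> B \in indep -> (#|A| < #|B|)%N ->
    exists2 x, x \in B :\: A & x |: A \in indep
}.

Section MatroidTheory.
Variables (n : nat) (M : matroid n).

Definition dependent (S : {set 'I_n}) : bool := S \notin indep M.

Definition circuit (C : {set 'I_n}) : bool := minset dependent C.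

Definition loop (i : 'I_n) : bool := dependent [set i].

Definition parallel (i j : 'I_n) : bool := circuit [set i; j].

Definition simple_matroid : Prop :=
  (forall i, ~~ loop i) /\ (forall i j, ~~ parallel i j).

Definition same_component (x y : 'I_n) : bool :=
  (x == y) || [exists C, [&& circuit C, x \in C & y \in C]].

Definition components : {set {set 'I_n}} :=
  equivalence_partition same_component [set: 'I_n].

Definition no_singleton_component : Prop :=
  forall X, X \in components -> #|X| != 1%N.

Definition connected_matroid : Prop := #|components| = 1%N.

End MatroidTheory.

(* The exterior algebra K<e_1, ..., e_n>, by coordinates in the basis (e_S):  *)
(* e_S e_T is 0 unless S and T are disjoint, and then it is                   *)
(* (-1)^(inversions S T) e_(S :|: T).                                         *)

Definition inversions (n : nat) (S T : {set 'I_n}) : nat :=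
  (\sum_(i in S) \sum_(j in T) (j < i))%N.

Definition exterior (K : fieldType) (n : nat) : Type := {ffun {set 'I_n} -> K^o}.

Section ExteriorRing.
Variables (K : fieldType) (n : nat).
Local Notation E := (exterior K n).
Implicit Types (a b c : E) (S T U V : {set 'I_n}).

HB.instance Definition _ := GRing.Lmodule.copy E {ffun {set 'I_n} -> K^o}.

Definition wedge a b : E :=
  [ffun U : {set 'I_n} => \sum_(S : {set 'I_n} | S \subset U)
     (-1) ^+ inversions S (U :\: S) * (a S * b (U :\: S))].

Definition wedge1 : E := [ffun S : {set 'I_n} => (S == set0)%:R].

Lemma inversionsUl S T U : [disjoint S & T] ->
  inversions (S :|: T) U = (inversions S U + inversions T U)%N.
Proof.
by move=> dST; rewrite /inversions -bigU //; apply: eq_bigl => i; rewrite !inE.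
Qed.

Lemma inversionsUr S T U : [disjoint T & U] ->
  inversions S (T :|: U) = (inversions S T + inversions S U)%N.
Proof.
move=> dTU; rewrite /inversions -big_split /=.
apply: eq_bigr => i _; rewrite -bigU //.
by apply: eq_bigl => j; rewrite !inE.
Qed.

Lemma inversions0l S : inversions set0 S = 0%N.
Proof. by rewrite /inversions big_set0. Qed.

Lemma inversions0r S : inversions S set0 = 0%N.
Proof. by rewrite /inversions big1 // => i _; rewrite big_set0. Qed.

Lemma wedgeA : associative wedge.
Proof.
move=> a b c; apply/ffunP => U; rewrite !ffunE.
pose F (S V : {set 'I_n}) : K :=
  (-1) ^+ (inversions S (U :\: S) + inversions (V :\: S) (U :\: V))
  * (a S * (b (V :\: S) * c (U :\: V))).
transitivity (\sum_(S : {set 'I_n} | S \subset U)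
  \sum_(V : {set 'I_n} | (S \subset V) && (V \subset U)) F S V).
  apply: eq_bigr => S sSU; rewrite ffunE !mulr_sumr.
  rewrite (reindex_onto (fun V : {set 'I_n} => V :\: S)
    (fun T : {set 'I_n} => S :|: T)) /=; last first.
    move=> T /subsetP sT; apply/setP => x; have := sT x; rewrite !inE.
    by case: (x \in S); case: (x \in T) => //= ->.
  apply: eq_big => [V|V].
    apply/andP/andP => [[sV /eqP eV] | [sSV sVU]].
      have sSV : S \subset V by rewrite -eV subsetUl.
      split=> //; apply/subsetP => x xV; have := subsetP sV x.
      rewrite !inE xV andbT; case xS: (x \in S) => H.
        exact: (subsetP sSU).
      by have /andP[] := H isT.
    split; first exact: setSD.
    by apply/eqP/setP => x; have := subsetP sSV x; rewrite !inE;
      case: (x \in S) => //= ->.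
  case/andP => _ /eqP eV.
  have sSV : S \subset V by rewrite -eV subsetUl.
  have -> : (U :\: S) :\: (V :\: S) = U :\: V.
    apply/setP => x; have := subsetP sSV x; rewrite !inE.
    by case: (x \in S); case: (x \in V); case: (x \in U) => //= hV;
      have := hV isT.
  by rewrite /F exprD -!mulrA; congr (_ * _); rewrite mulrCA.
rewrite (exchange_big_dep (fun V : {set 'I_n} => V \subset U)) /=; last first.
  by move=> S V _ /andP[].
apply: eq_bigr => V sVU; rewrite ffunE mulr_suml mulr_sumr.
apply: eq_big => [S|S /andP[sSU /andP[sSV _]]].
  rewrite sVU andbT; apply/andP/idP => [[]//|sSV]; split=> //.
  exact: subset_trans sVU.
have eUS : U :\: S = (V :\: S) :|: (U :\: V).
  apply/setP => x; have := subsetP sSV x; have := subsetP sVU x; rewrite !inE.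
  case: (x \in S); case: (x \in V); case: (x \in U) => //= hU hV;
    by [have := hU isT | have := hV isT].
have dVS : [disjoint V :\: S & U :\: V].
  by rewrite -setI_eq0; apply/eqP/setP => x; rewrite !inE;
    case: (x \in V); rewrite /= ?andbF.
have dSV : [disjoint S & V :\: S].
  by rewrite -setI_eq0; apply/eqP/setP => x; rewrite !inE;
    case: (x \in S); rewrite /= ?andbF.
have eV : V = S :|: (V :\: S).
  by apply/setP => x; have := subsetP sSV x; rewrite !inE;
    case: (x \in S) => //= ->.
have eI : (inversions S (U :\: S) + inversions (V :\: S) (U :\: V) =
           inversions V (U :\: V) + inversions S (V :\: S))%N.
  rewrite eUS (inversionsUr _ dVS) [RHS]addnC -addnA; congr (_ + _)%N.
  by rewrite -(inversionsUl _ dSV) -eV.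
by rewrite /F eI exprD !mulrA.
Qed.

Lemma wedge1l : left_id wedge1 wedge.
Proof.
move=> a; apply/ffunP => U; rewrite ffunE (bigD1 set0) ?sub0set //=.
rewrite inversions0l setD0 !ffunE eqxx !mul1r big1 ?addr0 // => S /andP[_ nS].
by rewrite ffunE (negbTE nS) mul0r mulr0.
Qed.

Lemma wedge1r : right_id wedge1 wedge.
Proof.
move=> a; apply/ffunP => U; rewrite ffunE (bigD1 U) //=.
rewrite setDv inversions0r !ffunE eqxx mul1r mulr1 big1 ?addr0 //.
move=> S /andP[sSU nS]; rewrite ffunE setD_eq0.
by have := nS; rewrite eqEsubset sSU /= => /negbTE->; rewrite !mulr0.
Qed.

Lemma wedgeDl : left_distributive wedge +%R.
Proof.
move=> a b c; apply/ffunP => U; rewrite !ffunE -big_split /=.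
by apply: eq_bigr => S _; rewrite !ffunE mulrDl mulrDr.
Qed.

Lemma wedgeDr : right_distributive wedge +%R.
Proof.
move=> a b c; apply/ffunP => U; rewrite !ffunE -big_split /=.
by apply: eq_bigr => S _; rewrite !ffunE !mulrDr.
Qed.

Lemma wedge1_neq0 : wedge1 != 0.
Proof.
by apply/eqP => /ffunP /(_ set0) /eqP; rewrite !ffunE eqxx oner_eq0.
Qed.

HB.instance Definition _ := GRing.Zmodule_isNzRing.Build E
  wedgeA wedge1l wedge1r wedgeDl wedgeDr wedge1_neq0.

Lemma wedgeZl (k : K) a b : k *: (a * b) = (k *: a) * b.
Proof.
apply/ffunP => U; rewrite !ffunE scaler_sumr; apply: eq_bigr => S _.
by rewrite !ffunE /GRing.scale /= mulrCA !mulrA.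
Qed.

HB.instance Definition _ := GRing.Lmodule_isLalgebra.Build K E wedgeZl.

Lemma wedgeZr (k : K) a b : k *: (a * b) = a * (k *: b).
Proof.
apply/ffunP => U; rewrite !ffunE scaler_sumr; apply: eq_bigr => S _.
by rewrite !ffunE /GRing.scale /= [LHS]mulrCA; congr (_ * _); rewrite mulrCA.
Qed.

HB.instance Definition _ := GRing.Lalgebra_isAlgebra.Build K E wedgeZr.

Definition ext_gen (i : 'I_n) : E := [ffun S : {set 'I_n} => (S == [set i])%:R].

(* enum S lists S in increasing order. *)
Definition ext_mon S : E := \prod_(i <- enum S) ext_gen i.

Definition ext_boundary S : E :=
  \sum_(i in S) (-1) ^+ #|[set k in S | (k < i)%N]| *: ext_mon (S :\ i).

Definition ext_homog (d : nat) a : Prop := forall S, a S != 0 -> #|S| = d.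

Lemma ext_monE S : ext_mon S = [ffun T : {set 'I_n} => (T == S)%:R].
Proof.
rewrite /ext_mon -[in RHS](set_enum S).
have : sorted (fun i j : 'I_n => (i < j)%N) (enum S).
  have := iota_ltn_sorted 0 n; rewrite -val_enum_ord sorted_map.
  rewrite {2}/enum_mem -enumT; apply: sorted_filter => i j k /=.
  exact: ltn_trans.
elim: (enum S) => [_|i s IHs] /=.
  rewrite big_nil; apply/ffunP => T; rewrite !ffunE; congr (_ == _)%:R.
move=> si; rewrite big_cons IHs ?(path_sorted si) //.
have {}si : all (fun j : 'I_n => (i < j)%N) s.
  by apply: order_path_min si => j k l; exact: ltn_trans.
apply/ffunP => T; rewrite !ffunE.
have iNs : i \notin [set j in s].
  by rewrite inE; apply/negP => /(allP si); rewrite ltnn.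
have -> : (T == [set j in i :: s]) = (i \in T) && (T :\ i == [set j in s]).
  apply/eqP/andP => [-> | [iT /eqP eT]].
    rewrite !inE eqxx; split=> //; apply/eqP/setP => j; rewrite !inE.
    by case: eqP => //= ->; rewrite -[_ \in s]in_set (negbTE iNs).
  by apply/setP => j; rewrite -(setD1K iT) eT !inE.
case iT: (i \in T); last first.
  rewrite big1 // => A sAT; rewrite !ffunE; case: eqP => [eA|]; last first.
    by rewrite mul0r mulr0.
  by move: sAT; rewrite eA sub1set iT.
rewrite (bigD1 [set i]) ?sub1set //= big1 ?addr0 => [|A /andP[_ /negbTE nA]].
  rewrite !ffunE eqxx mul1r; case: eqP => [->|]; last by rewrite mulr0.
  rewrite /inversions big_set1 big1 ?mulr1 // => j; rewrite inE.
  by move/(allP si) => /ltnW; rewrite leqNgt => /negbTE->.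
by rewrite !ffunE nA mul0r mulr0.
Qed.

End ExteriorRing.

(* Graded modules over E. A grading of a left E-module V is given by the     *)
(* predicate hom, hom j v meaning that v is homogeneous of degree j.          *)

Section LinearRelations.
Variables (K : fieldType) (n : nat).
Local Notation E := (exterior K n).

Definition submod_span (V : lmodType E) (A : V -> Prop) (v : V) : Prop :=
  exists (r : nat) (c : 'I_r -> E) (g : 'I_r -> V),
    (forall i, A (g i)) /\ v = \sum_(i < r) c i *: g i.

Definition generated_in_degree (V : lmodType E) (hom : nat -> V -> Prop)
    (N : V -> Prop) (m : nat) : Prop :=
  forall v, N v -> submod_span (fun w => N w /\ hom m w) v.

(* The free module with basis elements of degrees d 0, ..., d (r-1).          *)
Definition free_homog (r : nat) (d : 'I_r -> nat) (j : nat) (v : 'rV[E]_r) :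
    Prop :=
  forall i S, (v 0 i : E) S != 0 -> (#|S| + d i)%N = j.

Definition syzygy (V : lmodType E) (r : nat) (g : 'I_r -> V) (v : 'rV[E]_r) :
    Prop :=
  \sum_(i < r) v 0 i *: g i = 0.

(* The free cover mapping the basis of the graded free module to g, with      *)
(* image N; minimality says that the kernel lies in (e_1, ..., e_n) F.        *)
Definition minimal_cover (V : lmodType E) (hom : nat -> V -> Prop)
    (N : V -> Prop) (r : nat) (d : 'I_r -> nat) (g : 'I_r -> V) : Prop :=
  [/\ forall i, N (g i) /\ hom (d i) (g i),
      forall v, N v -> exists a : 'I_r -> E, v = \sum_(i < r) a i *: g i &
      forall v, syzygy g v -> forall i, (v 0 i : E) set0 = 0].

(* N is meant to be a graded submodule of V. *)
Definition has_linear_relations (V : lmodType E) (hom : nat -> V -> Prop)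
    (N : V -> Prop) : Prop :=
  exists m : nat, generated_in_degree hom N m /\
    exists (r : nat) (d : 'I_r -> nat) (g : 'I_r -> V),
      minimal_cover hom N d g /\
      generated_in_degree (free_homog d) (syzygy g) m.+1.

Definition OS_ideal (M : matroid n) (x : E) : Prop :=
  exists (r : nat) (a b : 'I_r -> E) (S : 'I_r -> {set 'I_n}),
    (forall i, dependent M (S i)) /\
    x = \sum_(i < r) a i * ext_boundary K (S i) * b i.

End LinearRelations.

(* Main.v *)
(* Suppose M is the direct sum of matroids on nonempty X and ~X. If J is generated
   in degree m, then its degree-m part is spanned by the boundaries of the circuits
   of size m + 1, each inside X or inside ~X, and both kinds occur; simplicity gives
   m >= 2. Counting degrees in the X- and ~X-variables, a linear syzygy is then a
   sum of a syzygy of the generators inside X and one of those inside ~X. But for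
   boundaries f1, f2 of circuits in X and in ~X the Koszul relation
   f2 f1 = +- f1 f2 is a syzygy whose X-part is f2 f1 <> 0.
   Connectedness in the sense of one equivalence class needs the transitivity of
   "lie on a common circuit", which comes from strong circuit elimination. *)
Require Import Defs.
From mathcomp Require Import all_boot all_order all_algebra.

Set Implicit Arguments.
Unset Strict Implicit.
Unset Printing Implicit Defensive.

Import GRing.Theory.

Local Open Scope ring_scope.

(** * Circuits: strong elimination, transitivity and separators *)

Section Circuits.
Variables (n : nat) (M : matroid n).
Implicit Types (A B C D I W : {set 'I_n}) (x y z : 'I_n).

Lemma circuit_dependent C : circuit M C -> dependent M C.
Proof. by case/minsetP. Qed.

Lemma dependentS A B : dependent M A -> A \subset B -> dependent M B.
Proof. by move=> dA sAB; apply: contra dA => /indepS; apply. Qed.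

Lemma circuit_sub_dependent A :
  dependent M A -> exists2 C, circuit M C & C \subset A.
Proof. by move=> dA; have [C] := minset_exists dA; exists C. Qed.

Lemma circuitD1_indep C x : circuit M C -> x \in C -> C :\ x \in indep M.
Proof.
move=> cC xC; apply/negPn/negP => d; case/minsetP: cC => _ /(_ _ d (subsetDl _ _)).
by move/setP/(_ x); rewrite !inE eqxx xC.
Qed.

Lemma circuit_sub_eq C D : circuit M C -> circuit M D -> D \subset C -> D = C.
Proof. by case/minsetP => _ min /circuit_dependent dD; apply: min. Qed.

Lemma indep_extend A W : A \in indep M -> A \subset W ->
  exists I, [/\ A \subset I, I \subset W, I \in indep M &
    forall x, x \in W -> x \notin I -> x |: I \notin indep M].
Proof.
move=> iA sAW; pose P B := (B \in indep M) && (B \subset W).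
have PA : P A by rewrite /P iA.
have [I /maxsetP[/andP[iI sIW] max] sAI] := maxset_exists PA.
exists I; split=> // x xW xI; apply: contra xI => ixI.
by rewrite -(max (x |: I)) ?setU11 ?subsetUr // /P ixI subUset sub1set xW.
Qed.

(** Extend [C2 :\ z] to [I], maximal independent in [W :\ z :\ x]. If [x |: I] is dependent, it
    contains a circuit, which must use [x] and avoids [z]. Otherwise [I] is also maximal in
    [W :\ x], since adding [z] completes [C2]. An independent [I'] containing [C1 :\ x] and maximal
    in [W :\ x] has at most [#|I|] elements, so exchange with [x |: I] enlarges it: by [x], which
    completes [C1], or within [W :\ x], against maximality. *)
Lemma strong_circuit_elimination C1 C2 x z :
  circuit M C1 -> circuit M C2 -> z \in C1 -> z \in C2 ->
  x \in C1 -> x \notin C2 ->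
  exists C, [/\ circuit M C, x \in C & C \subset (C1 :|: C2) :\ z].
Proof.
move=> c1 c2 z1 z2 x1 x2; set W := C1 :|: C2.
have xz : x != z by apply: contraNneq x2 => ->.
have [||I [sI sIW iI maxI]] := @indep_extend (C2 :\ z) (W :\ z :\ x).
- exact: circuitD1_indep.
- apply/subsetP => y; rewrite !inE => /andP[-> y2]; rewrite y2 orbT !andbT.
  by apply: contraNneq x2 => <-.
have xI : x \notin I by apply/negP => /(subsetP sIW); rewrite !inE eqxx.
case: (boolP (x |: I \in indep M)) => [ixI|/circuit_sub_dependent[C cC sC]]; last first.
  exists C; split=> //.
    apply/negPn/negP => xC; have/negP := circuit_dependent cC; apply.
    apply: indepS iI _; apply/subsetP => y yC; have := subsetP sC y yC.
    by rewrite !inE; case: eqP => // eyx; rewrite -eyx yC in xC.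
  apply: subset_trans sC _; rewrite subUset sub1set !inE xz x1 /=.
  exact: subset_trans sIW (subsetDl _ _).
have maxI' y : y \in W :\ x -> y \notin I -> y |: I \notin indep M.
  case: (eqVneq y z) => [-> _ _|yz]; last first.
    by move=> yW; apply: maxI; move: yW; rewrite !inE yz andbC.
  apply: dependentS (circuit_dependent c2) _.
  by rewrite -(setD1K z2) setUS.
have [||I' [sI' sI'W iI' max']] := @indep_extend (C1 :\ x) (W :\ x).
- exact: circuitD1_indep.
- exact: setSD (subsetUl _ _).
have le_card : (#|I'| <= #|I|)%N.
  rewrite leqNgt; apply/negP => /(indep_exchange iI iI')[y].
  rewrite inE => /andP[yI yI'] iy.
  by have := maxI' y (subsetP sI'W y yI') yI; rewrite iy.
have [|y] := indep_exchange iI' ixI; first by rewrite cardsU1 xI add1n ltnS.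
rewrite !inE => /andP[yI'] /orP[/eqP->|yI] iy.
  suff: x |: I' \notin indep M by rewrite iy.
  apply: dependentS (circuit_dependent c1) _.
  by rewrite -(setD1K x1) setUS.
have yW : y \in W :\ x by have := subsetP sIW y yI; rewrite !inE => /and3P[-> _ ->].
by have := max' y yW yI'; rewrite iy.
Qed.

(* A pair [C1], [C2] with [C1 :|: C2] of minimal size has a common element [z];
   eliminating [z] from it towards [x] and towards [y] gives [C3] and [C4], which
   meet and have a union avoiding [z]. *)
Lemma circuit_through C1 C2 x y :
  circuit M C1 -> circuit M C2 -> C1 :&: C2 != set0 -> x \in C1 -> y \in C2 ->
  exists C, [/\ circuit M C, x \in C & y \in C].
Proof.
have [k] := ubnP #|C1 :|: C2|; elim: k C1 C2 => // k IH C1 C2 lek c1 c2 meet x1 y2.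
case: (boolP (x \in C2)) => [x2|x2]; first by exists C2.
case: (boolP (y \in C1)) => [y1|y1]; first by exists C1.
have/set0Pn[z] := meet; rewrite inE => /andP[z1 z2].
have not_sub A B : circuit M A -> circuit M B -> z \in A -> z \notin B ->
    exists2 t, t \in B & t \notin A.
  move=> cA cB zA zB; apply/subsetPn; apply: contra zB => sBA.
  by rewrite (circuit_sub_eq cA cB sBA).
have [C3 [c3 x3 s3]] := strong_circuit_elimination c1 c2 z1 z2 x1 x2.
have [C4 [c4 y4]] := strong_circuit_elimination c2 c1 z2 z1 y2 y1.
rewrite [C2 :|: C1]setUC => s4.
have [z3 z4] : z \notin C3 /\ z \notin C4.
  by split; [apply: contraTN isT => /(subsetP s3)|apply: contraTN isT => /(subsetP s4)];
    rewrite !inE eqxx.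
have [t t3 t1] := not_sub _ _ c1 c3 z1 z3.
have t2 : t \in C2.
  by have := subsetP s3 t t3; rewrite !inE (negbTE t1) => /andP[].
have [u u4 u2] := not_sub _ _ c2 c4 z2 z4.
have u1 : u \in C1.
  by have := subsetP s4 u u4; rewrite !inE (negbTE u2) orbF => /andP[].
have sW3 := subset_trans s3 (subsetDl _ _).
have sW4 := subset_trans s4 (subsetDl _ _).
have sub14 : C1 :|: C4 \subset C1 :|: C2 by rewrite subUset subsetUl.
(* If [C1 :|: C4] is strictly smaller, induction applies to this pair, which meets in [u]. Otherwise
   [t], lying outside [C1], must be in [C4], which is why [C3] and [C4] meet. *)
case: (eqVneq (C1 :|: C4) (C1 :|: C2)) => [e14|ne]; last first.
  apply: (IH C1 C4) => //; last by apply/set0Pn; exists u; rewrite inE u1.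
  by rewrite -ltnS; apply: leq_trans lek; rewrite ltnS proper_card // properEneq ne.
have t4 : t \in C4.
  by have : t \in C1 :|: C4; [rewrite e14 !inE t2 orbT|rewrite !inE (negbTE t1)].
apply: (IH C3 C4) => //; last by apply/set0Pn; exists t; rewrite inE t3.
rewrite -ltnS; apply: leq_trans lek; rewrite ltnS; apply: proper_card.
apply/properP; split; first by rewrite subUset sW3.
by exists z; rewrite !inE ?z1 // negb_or z3.
Qed.

Lemma same_component_sym x y : same_component M x y = same_component M y x.
Proof.
rewrite /same_component eq_sym; congr (_ || _).
by apply: eq_existsb => C; rewrite [(x \in C) && _]andbC.
Qed.

Lemma same_component_circuit x y C :
  circuit M C -> x \in C -> y \in C -> same_component M x y.
Proof.
by move=> cC xC yC; apply/orP; right; apply/existsP; exists C; rewrite cC xC.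
Qed.

Lemma same_component_trans x y z :
  same_component M x y -> same_component M y z -> same_component M x z.
Proof.
case/predU1P => [-> //|/existsP[C1 /and3P[c1 x1 y1]]].
case/predU1P => [<-|/existsP[C2 /and3P[c2 y2 z2]]].
  exact: same_component_circuit c1 _ _.
have [|C [cC xC zC]] := circuit_through c1 c2 _ x1 z2.
  by apply/set0Pn; exists y; rewrite inE y1.
exact: same_component_circuit cC _ _.
Qed.

(** An element on no circuit is related only to itself, so its class would be a singleton. *)
Lemma component_circuit x : no_singleton_component M ->
  exists2 C, circuit M C & x \in C.
Proof.
move=> nsc; case: (boolP [exists C, circuit M C && (x \in C)]) => [|none].
  by case/existsP => C /andP[]; exists C.
have/eqP[] := nsc _ (imset_f _ (in_setT x)).
apply/eqP/cards1P; exists x; apply/setP => y; rewrite !inE /same_component eq_sym.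
case: (eqVneq y x) => //= _; apply: contraNF none => /existsP[C /and3P[cC xC _]].
by apply/existsP; exists C; rewrite cC.
Qed.

Lemma simple_dependent_card A : simple_matroid M -> dependent M A -> (2 < #|A|)%N.
Proof.
case=> nloop npar /circuit_sub_dependent[C cC sCA].
apply: leq_trans (subset_leq_card sCA); have dC := circuit_dependent cC.
case E: #|C| => [|[|[|k]]] //.
- by move: dC; rewrite (cards0_eq E) /dependent indep0.
- have /cards1P[x eC] : #|C| == 1%N by rewrite E.
  by have := nloop x; rewrite /loop -eC dC.
- have /cards2P[x [y [_ eC]]] : #|C| == 2%N by rewrite E.
  by have := npar x y; rewrite /parallel -eC cC.
Qed.

(** [X] is the class of a chosen point; by transitivity a circuit meeting it stays inside. Were [X]
    everything, [setT] would be the only component. *)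
Lemma disconnected_separator : (0 < n)%N -> #|components M| <> 1%N ->
  exists (X : {set 'I_n}) x y, [/\ x \in X, y \notin X &
    forall C, circuit M C -> C \subset X \/ C \subset ~: X].
Proof.
move=> n_gt0 disc; pose x0 := Ordinal n_gt0.
pose X := [set y | same_component M x0 y].
have x0X : x0 \in X by rewrite inE /same_component eqxx.
case: (boolP [forall y, y \in X]) => [/forallP allX|]; last first.
  rewrite negb_forall => /existsP[y yX]; exists X, x0, y; split=> // C cC.
  have [/eqP|/set0Pn[z]] := eqVneq (C :&: X) set0.
    by rewrite setI_eq0 disjoints_subset; right.
  rewrite !inE => /andP[zC x0z]; left; apply/subsetP => t tC; rewrite inE.
  exact: same_component_trans x0z (same_component_circuit cC zC tC).
case: disc; apply/eqP/cards1P; exists setT; apply/setP => A; rewrite [RHS]inE.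
have classT x : [set y in setT | same_component M x y] = setT.
  apply/setP => y; rewrite !inE /=; apply: (@same_component_trans _ x0).
    by rewrite same_component_sym; have := allX x; rewrite inE.
  by have := allX y; rewrite inE.
apply/imsetP/eqP => [[x _ ->] //|->]; by exists x0.
Qed.

End Circuits.

(** * Signs, supports and products in the exterior algebra *)

Section ExteriorAlgebra.
Variables (K : fieldType) (n : nat).
Local Notation E := (exterior K n).
Implicit Types (a b f g : E) (S T U X : {set 'I_n}).

Lemma extME a b U : (a * b) U = \sum_(S : {set 'I_n} | S \subset U)
  (-1) ^+ inversions S (U :\: S) * (a S * b (U :\: S)).
Proof. by rewrite [LHS]ffunE. Qed.

Lemma extZE (k : K) a U : (k *: a) U = k * a U.
Proof. by rewrite ffunE. Qed.

Lemma sum_neq0 (I : finType) (P : pred I) (F : I -> K) :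
  \sum_(i | P i) F i != 0 -> exists2 i, P i & F i != 0.
Proof.
move=> nz; case: (boolP [exists i, P i && (F i != 0)]) => [|none].
  by case/existsP => i /andP[]; exists i.
case/eqP: nz; apply: big1 => i Pi; apply/eqP; apply: contraNT none => Fi.
by apply/existsP; exists i; rewrite Pi.
Qed.

Lemma extM_neq0 a b U : (a * b) U != 0 ->
  exists S, [/\ S \subset U, a S != 0 & b (U :\: S) != 0].
Proof.
rewrite extME => /sum_neq0[S sSU]; rewrite !mulf_eq0 !negb_or => /and3P[_ aS bS].
by exists S.
Qed.

(** Since [i] in [S] and [j] in [T] differ, each pair is an inversion in exactly one of the two
    orders. *)
Lemma inversionsC S T : [disjoint S & T] ->
  (inversions S T + inversions T S = #|S| * #|T|)%N.
Proof.
move=> dST; rewrite /inversions [X in (_ + X)%N]exchange_big -big_split /=.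
rewrite -sum_nat_const; apply: eq_bigr => i iS.
rewrite -big_split /= -sum1_card; apply: eq_bigr => j jT.
have/eqP : i != j by apply: contraTneq iS => ->; rewrite (disjointFl dST).
by case: (ltngtP j i) => // eij []; apply: val_inj.
Qed.

(** Exchanging [S] with [U :\: S] matches the terms of the two products; [inversionsC] compares
    their signs. *)
Lemma extMC p q a b : ext_homog p a -> ext_homog q b ->
  a * b = (-1) ^+ (p * q) *: (b * a).
Proof.
move=> ha hb; apply/ffunP => U; rewrite extZE !extME mulr_sumr.
rewrite (reindex_onto (fun S => U :\: S) (fun S => U :\: S)) /=; last first.
  by move=> S sSU; rewrite setDDr setDv set0U; apply/setIidPr.
apply: eq_big => [S|S /andP[_ /eqP eS]].
  rewrite subsetDl setDDr setDv set0U /=; apply/eqP/idP => [<-|/setIidPr//].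
  exact: subsetIl.
rewrite eS; have [->|aS] := eqVneq (a (U :\: S)) 0.
  by rewrite mul0r !mulr0.
have [->|bS] := eqVneq (b S) 0; first by rewrite mul0r !mulr0.
have dUS : [disjoint U :\: S & S].
  by rewrite disjoints_subset; apply/subsetP => x; rewrite !inE => /andP[].
rewrite -(ha _ aS) -(hb _ bS) -(inversionsC dUS) mulrA.
by rewrite exprD -!mulrA signrMK [a _ * _]mulrC.
Qed.

(** The factors involve disjoint sets of variables, so [S :|: T] splits in only one way and nothing
    can cancel. *)
Lemma extM_disjoint X (Y : {set 'I_n}) a b S T :
  [disjoint X & Y] -> S \subset X -> T \subset Y ->
  (forall U, a U != 0 -> U \subset X) -> (forall U, b U != 0 -> U \subset Y) ->
  (a * b) (S :|: T) = (-1) ^+ inversions S T * (a S * b T).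
Proof.
move=> dXY sSX sTY aX bY.
have cutS (A : {set 'I_n}) : A \subset X -> (S :|: T) :\: A \subset Y -> A \subset S :|: T -> A = S.
  move=> sAX sY sA; apply/setP => x; apply/idP/idP => [xA|xS].
    have := subsetP sA x xA; rewrite inE => /orP[//|/(subsetP sTY)].
    by rewrite (disjointFr dXY (subsetP sAX x xA)).
  apply/negPn/negP => xA; have := disjointFr dXY (subsetP sSX x xS).
  by rewrite (subsetP sY) // !inE xA xS.
have eT : (S :|: T) :\: S = T.
  apply/setP => x; rewrite !inE; case: (boolP (x \in S)) => //= xS.
  have := disjointFr dXY (subsetP sSX x xS).
  by move=> xY; apply/esym/(contraFF _ xY)/(subsetP sTY).
rewrite extME (bigD1 S) ?subsetUl //= eT big1 ?addr0 // => A /andP[sA nA].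
apply/eqP; apply: contraNT nA; rewrite !mulf_eq0 !negb_or => /and3P[_ aA bA].
by apply/eqP/cutS; [exact: aX|exact: bY|].
Qed.

Lemma ext_boundaryE S T :
  ext_boundary K S T = \sum_(i in S) (-1) ^+ #|[set k in S | (k < i)%N]| * (T == S :\ i)%:R.
Proof.
rewrite /ext_boundary sum_ffunE; apply: eq_bigr => i _.
by rewrite ffunE ext_monE ffunE.
Qed.

Lemma ext_boundary_neq0 S T :
  ext_boundary K S T != 0 -> exists2 i, i \in S & T = S :\ i.
Proof.
rewrite ext_boundaryE => /sum_neq0[i iS]; rewrite mulf_eq0 negb_or.
by case: (eqVneq T (S :\ i)) => [->|_]; [exists i|rewrite eqxx andbF].
Qed.

Lemma ext_boundaryD1 S i : i \in S -> ext_boundary K S (S :\ i) != 0.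
Proof.
move=> iS; rewrite ext_boundaryE (bigD1 i) //= eqxx mulr1 big1 ?addr0 ?signr_eq0 //.
move=> j /andP[jS ji]; case: eqP => [/setP/(_ i)|]; last by rewrite mulr0.
by rewrite !inE eqxx iS eq_sym ji.
Qed.

Lemma ext_boundary_homog S m : #|S| = m.+1 -> ext_homog m (ext_boundary K S).
Proof.
move=> eS T /ext_boundary_neq0[i iS ->]; apply/eqP.
by rewrite -eqSS -eS (cardsD1 i S) iS.
Qed.

(** This amounts to setting the variables outside [X] to zero. *)
Definition ext_restrict X a : E := [ffun U : {set 'I_n} => if U \subset X then a U else 0].

Lemma ext_restrict_neq0 X a U :
  ext_restrict X a U != 0 -> U \subset X /\ a U != 0.
Proof. by rewrite ffunE; case: ifP => //; rewrite eqxx. Qed.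

Lemma ext_restrict_sum X r (k : 'I_r -> K) (g : 'I_r -> E) :
  ext_restrict X (\sum_i k i *: g i) = \sum_i k i *: ext_restrict X (g i).
Proof.
apply/ffunP => U; rewrite ffunE !sum_ffunE; case: ifP => sU.
  by apply: eq_bigr => i _; rewrite !ffunE sU.
by rewrite big1 // => i _; rewrite !ffunE sU scaler0.
Qed.

End ExteriorAlgebra.

(** * Monomials occurring in the Orlik-Solomon ideal *)

Section OrlikSolomon.
Variables (K : fieldType) (n : nat) (M : matroid n).
Local Notation E := (exterior K n).
Local Notation J := (@OS_ideal K n M).
Implicit Types (C S T U X : {set 'I_n}).

Lemma OS_ideal_boundary S : dependent M S -> J (ext_boundary K S).
Proof.
move=> dS; exists 1%N, (fun=> 1), (fun=> 1), (fun=> S); split=> //.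
by rewrite big_ord1 mul1r mulr1.
Qed.

Lemma OS_ideal_support (x : E) U : J x -> x U != 0 ->
  exists S i, [/\ dependent M S, i \in S & S :\ i \subset U].
Proof.
case=> r [a [b [S [dS ->]]]]; rewrite sum_ffunE => /sum_neq0[k _].
case/extM_neq0 => T [sTU + _]; case/extM_neq0 => T' [sT'T _].
case/ext_boundary_neq0 => i iS eT; exists (S k), i; split=> //.
by rewrite -eT (subset_trans (subsetDl _ _)).
Qed.

(** * Consequences of generation in a single degree *)

Section Degree.
Variable m : nat.
Hypothesis genJ : generated_in_degree (V := E^o) (@ext_homog K n) J m.

Lemma generator_support (x : E) U : J x -> x U != 0 ->
  exists (y : E) T, [/\ J y, ext_homog m y, T \subset U & y T != 0].
Proof.
move=> /genJ[r [c [g [Jg ->]]]]; rewrite sum_ffunE => /sum_neq0[i _].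
case/extM_neq0 => T [_ _ gT]; have [Ji hi] := Jg i.
by exists (g i), (U :\: T); split=> //; exact: subsetDl.
Qed.

Lemma OS_ideal_ge (x : E) U : J x -> x U != 0 -> (m <= #|U|)%N.
Proof.
move=> Jx /(generator_support Jx)[y [T [_ hy sTU /hy <-]]].
exact: subset_leq_card.
Qed.

(** A dependent set is nonempty, so its boundary has a monomial of degree [#|S| - 1], while the
    ideal has none below degree [m]. *)
Lemma dependent_gt S : dependent M S -> (m < #|S|)%N.
Proof.
move=> dS; have [S0|/set0Pn[i iS]] := eqVneq S set0.
  by move: dS; rewrite S0 /dependent indep0.
rewrite (cardsD1 i S) iS ltnS.
exact: OS_ideal_ge (OS_ideal_boundary dS) (ext_boundaryD1 K iS).
Qed.

Lemma small_dependent_circuit S : dependent M S -> #|S| = m.+1 -> circuit M S.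
Proof.
move=> dS eS; apply/minsetP; split=> // A dA sAS; apply/eqP.
by rewrite eqEcard sAS eS dependent_gt.
Qed.

(** [U] contains some [S :\ i] with [S] dependent. As [#|U| = m < #|S|], this inclusion is an
    equality and [S] has the least size possible for a dependent set. *)
Lemma OS_ideal_homog_support (x : E) U : J x -> ext_homog m x -> x U != 0 ->
  exists C i, [/\ circuit M C, #|C| = m.+1, i \in C & U = C :\ i].
Proof.
move=> Jx hx xU; have [S [i [dS iS sSU]]] := OS_ideal_support Jx xU.
have eU := hx _ xU; have eS := cardsD1 i S; rewrite iS in eS.
have eSU : S :\ i = U.
  by apply/eqP; rewrite eqEcard sSU eU -ltnS -(add1n #|_|) -eS dependent_gt.
have cS : #|S| = m.+1 by rewrite eS eSU eU.
by exists S, i; split=> //; apply: small_dependent_circuit.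
Qed.

(** A monomial of the boundary of [C] contains a monomial of a degree [m] element of [J], and the
    latter is a circuit of size [m.+1] minus a point. *)
Lemma circuit_degree_circuit C : circuit M C ->
  exists D i, [/\ circuit M D, #|D| = m.+1, i \in D & D :\ i \subset C].
Proof.
move=> /circuit_dependent dC.
have/card_gt0P[i iC] : (0 < #|C|)%N by apply: leq_ltn_trans (dependent_gt dC).
have [y [T [Jy hy sTC yT]]] :=
  generator_support (OS_ideal_boundary dC) (ext_boundaryD1 K iC).
have [D [j [cD eD jD eT]]] := OS_ideal_homog_support Jy hy yT.
by exists D, j; split=> //; rewrite -eT (subset_trans sTC) ?subsetDl.
Qed.

Lemma degree_gt1 C : simple_matroid M -> circuit M C -> (1 < m)%N.
Proof.
move=> simpleM /circuit_degree_circuit[D [_ [/circuit_dependent dD eD _ _]]].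
by have := simple_dependent_card simpleM dD; rewrite eD.
Qed.

Section Separator.
Variable X : {set 'I_n}.
Hypothesis sepX : forall C, circuit M C -> C \subset X \/ C \subset ~: X.

Lemma homog_separated (x : E) U : J x -> ext_homog m x -> x U != 0 ->
  U \subset X \/ U \subset ~: X.
Proof.
move=> Jx hx /(OS_ideal_homog_support Jx hx)[C [i [/sepX cC _ _ ->]]].
by case: cC => sC; [left|right]; apply: subset_trans (subsetDl _ _) sC.
Qed.

(** The circuit found near [C] may leave [C] in one point [j]. The rest is nonempty as [m > 0] and
    lies in [X], so the circuit cannot be on the other side. *)
Lemma small_circuit_in_separator C : (0 < m)%N ->
  circuit M C -> C \subset X ->
  exists D, [/\ circuit M D, #|D| = m.+1 & D \subset X].
Proof.
move=> m_gt0 cC sCX; have [D [j [cD eD jD sDC]]] := circuit_degree_circuit cC.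
exists D; split=> //; case: (sepX cD) => // sDX.
have/card_gt0P[k kD] : (0 < #|D :\ j|)%N.
  by move: eD; rewrite (cardsD1 j) jD add1n => -[->].
have /(subsetP sDX) : k \in D by move: kD; rewrite inE => /andP[].
by rewrite inE (subsetP sCX) ?(subsetP sDC).
Qed.

End Separator.

(** * Linear syzygies of a minimal cover *)

Variables (r : nat) (d : 'I_r -> nat) (g : 'I_r -> E).
Hypothesis cover : minimal_cover (V := E^o) (@ext_homog K n) J d g.

Lemma cover_J i : J (g i). Proof. by case: cover => /(_ i)[]. Qed.

Lemma cover_homog i : ext_homog (d i) (g i).
Proof. by case: cover => /(_ i)[]. Qed.

(** The generators have no monomials below degree [m], so in degree [m] only the constant terms of
    the coefficients contribute. *)
Lemma homog_scalar_combination (x : E) : J x -> ext_homog m x ->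
  exists k : 'I_r -> K, x = \sum_i k i *: g i.
Proof.
move=> Jx hx; case: cover => _ /(_ x Jx)[a ea] _.
(* Generators of other degrees get coefficient 0, so that nothing appears outside degree [m]. *)
exists (fun i => if d i == m then a i set0 else 0).
apply/ffunP => U; rewrite sum_ffunE.
have [eU|neU] := eqVneq #|U| m; last first.
  have [->|/hx eU] := eqVneq (x U) 0; last by rewrite eU eqxx in neU.
  rewrite big1 // => i _; rewrite extZE; case: eqP => [di|]; last by rewrite mul0r.
  have [->|/cover_homog eU] := eqVneq (g i U) 0; first by rewrite mulr0.
  by rewrite eU di eqxx in neU.
rewrite ea sum_ffunE; apply: eq_bigr => i _; rewrite extZE.
rewrite [LHS]extME (bigD1 set0) ?sub0set //= setD0 inversions0l mul1r.
rewrite big1 ?addr0 => [|S /andP[sSU S0]]; last first.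
  apply/eqP; apply: contraNT S0; rewrite !mulf_eq0 !negb_or => /and3P[_ _ gS].
  have := OS_ideal_ge (cover_J i) gS; rewrite -eU cardsDS // -cards_eq0.
  have : (#|S| <= #|U|)%N := subset_leq_card sSU.
  by case: #|S| => // s; case: #|U| => // u _; rewrite subSS leqNgt ltnS leq_subr.
case: eqP => // di; have [->|/cover_homog gU] := eqVneq (g i U) 0.
  by rewrite !mulr0.
by case: di; rewrite -gU.
Qed.

(** The parts [P] and [Q] coming from [X] and [~: X] add up to zero, so they have the same
    monomials. A monomial of [P] has at most one variable outside [X], while one of [Q] has at least
    [m > 1] variables in [~: X]; hence both vanish. *)
Lemma linear_syzygy_restrict X (w : 'rV[E]_r) : (1 < m)%N ->
  (forall C, circuit M C -> C \subset X \/ C \subset ~: X) ->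
  syzygy (V := E^o) g w -> free_homog d m.+1 w ->
  \sum_i w 0 i * ext_restrict X (g i) = 0.
Proof.
move=> m_gt1 sepX syz hw.
set P := \sum_i _; pose Q : E := \sum_i w 0 i * ext_restrict (~: X) (g i).
have w0 i : (w 0 i : E) set0 = 0 by case: cover => _ _ /(_ w syz i).
have PQ : P + Q = 0.
  rewrite -[RHS]syz -big_split /=; apply: eq_bigr => i _.
  rewrite -mulrDr; apply/ffunP => U; rewrite !extME; apply: eq_bigr => S sSU.
  congr (_ * _); have [->|wS] := eqVneq ((w 0 i : E) S) 0; first by rewrite !mul0r.
  congr (_ * _); rewrite !ffunE; set T := U :\: S.
  have [gT|gT] := eqVneq (g i T) 0; first by rewrite gT !if_same addr0.
  (* Minimality makes [S] nonempty, so [#|S| + d i = m.+1] gives [d i <= m]; the reverse bound holds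
     because [g i] is a nonzero element of [J]. *)
  have di : d i = m.
    have := OS_ideal_ge (cover_J i) gT; rewrite (cover_homog gT) => le_m.
    have := hw i S wS; have : (0 < #|S|)%N.
      by rewrite card_gt0; apply: contraNneq wS => ->; rewrite w0.
    case: #|S| => // s _; rewrite addSn => -[] e.
    by apply/eqP; rewrite eqn_leq le_m andbT -e leq_addl.
  have T_gt0 : (0 < #|T|)%N by rewrite (cover_homog gT) di ltnW.
  have hg : ext_homog m (g i) by rewrite -di; apply: cover_homog.
  have [sTX|sTX] := homog_separated sepX (cover_J i) hg gT.
    rewrite sTX ifF ?addr0 //; apply/negP => sTX'.
    move/card_gt0P: T_gt0 => [x xT].
    by have := subsetP sTX' x xT; rewrite inE (subsetP sTX).
  rewrite sTX ifF ?add0r //; apply/negP => sTX'.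
  move/card_gt0P: T_gt0 => [x xT].
  by have := subsetP sTX x xT; rewrite inE (subsetP sTX').
have supp Y U : (\sum_i w 0 i * ext_restrict Y (g i)) U != 0 ->
    exists S, [/\ S \subset U, U :\: S \subset Y, (#|S| <= 1)%N & (m <= #|U :\: S|)%N].
  rewrite sum_ffunE => /sum_neq0[i _] /extM_neq0[S [sSU wS]].
  case/ext_restrict_neq0 => sY gS; exists S; split=> //; last first.
    exact: OS_ideal_ge (cover_J i) gS.
  have := OS_ideal_ge (cover_J i) gS; rewrite (cover_homog gS) => le_m.
  have := hw i S wS; case: #|S| => [|[|s]] // e.
  by move: le_m; rewrite -ltnS -e !addSn !ltnS leqNgt ltnS leq_addl.
apply/ffunP => U; rewrite [RHS]ffunE; apply/eqP/negPn/negP => PU.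
have QU : Q U != 0.
  by rewrite -(addr0_eq PQ) ffunE oppr_eq0.
have [S [_ sX leS _]] := supp _ _ PU; have [T [_ sX' _ leT]] := supp _ _ QU.
suff sTS : U :\: T \subset S.
  have := leq_trans leT (leq_trans (subset_leq_card sTS) leS).
  by rewrite leqNgt m_gt1.
apply/subsetP => x xT; apply/negPn/negP => xS.
have : x \in X.
  by apply: (subsetP sX); move: xT; rewrite !inE xS => /andP[_ ->].
by apply/negP; have := subsetP sX' x xT; rewrite inE.
Qed.

End Degree.
End OrlikSolomon.

(** * The Koszul syzygy across a separation *)

Theorem theorem6p9 (n : nat) (M : matroid n) (K : fieldType) :
  (0 < n)%N ->
  simple_matroid M ->
  no_singleton_component M ->
  @has_linear_relations K n (exterior K n)^o (@ext_homog K n) (@OS_ideal K n M) ->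
  connected_matroid M.
Proof.
move=> n_gt0 simpleM nsc [m [genJ [r [d [g [cover lin]]]]]].
apply/eqP/negPn/negP => /eqP disc.
have [X [x [y [xX yX sepX]]]] := disconnected_separator n_gt0 disc.
have sepX' C : circuit M C -> C \subset ~: X \/ C \subset ~: ~: X.
  by rewrite setCK => /sepX[]; [right|left].
have [C1 cC1 xC1] := component_circuit x nsc.
have [C2 cC2 yC2] := component_circuit y nsc.
have sC1 : C1 \subset X.
  by case: (sepX _ cC1) => // /subsetP/(_ x xC1); rewrite inE xX.
have sC2 : C2 \subset ~: X.
  by case: (sepX _ cC2) => // /subsetP/(_ y yC2) yX'; rewrite yX' in yX.
have m_gt1 := degree_gt1 genJ simpleM cC1; have m_gt0 := ltnW m_gt1.
have [D1 [cD1 eD1 sD1]] := small_circuit_in_separator genJ sepX m_gt0 cC1 sC1.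
have [D2 [cD2 eD2 sD2]] := small_circuit_in_separator genJ sepX' m_gt0 cC2 sC2.
pose f1 : exterior K n := ext_boundary K D1.
pose f2 : exterior K n := ext_boundary K D2.
have Jf1 : OS_ideal M f1 := OS_ideal_boundary K (circuit_dependent cD1).
have Jf2 : OS_ideal M f2 := OS_ideal_boundary K (circuit_dependent cD2).
have hf1 : ext_homog m f1 := ext_boundary_homog eD1.
have hf2 : ext_homog m f2 := ext_boundary_homog eD2.
have [k1 ek1] := homog_scalar_combination genJ cover Jf1 hf1.
have [k2 ek2] := homog_scalar_combination genJ cover Jf2 hf2.
(* The Koszul relation between [f1] and [f2], rewritten on the generators [g] through the scalars
   [k1] and [k2]; the sign is that of [extMC] in degrees [m] and [m]. *)
pose v : 'rV[exterior K n]_r :=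
  \row_i (k1 i *: f2 - k2 i *: ((-1) ^+ (m * m) *: f1)).
(* Stated for arbitrary [h] to serve twice: with [g] for the syzygy, and with the restrictions of
   [g] for [Phi v]. *)
have phi h : \sum_i v 0 i * h i =
    f2 * (\sum_i k1 i *: h i) - (-1) ^+ (m * m) *: (f1 * \sum_i k2 i *: h i).
  rewrite !mulr_sumr scaler_sumr -sumrB; apply: eq_bigr => i _.
  rewrite mxE mulrBl -!scalerAl -!scalerAr; congr (_ - _).
  by rewrite !scalerA mulrC.
have syz_v : syzygy (V := (exterior K n)^o) g v.
  rewrite /syzygy [LHS]phi -ek1 -ek2 (extMC hf2 hf1).
  by rewrite subrr.
(* Linear syzygies do not mix the generators supported in [X] with those
   supported in [~: X], so [Phi] kills them; the Koszul syzygy [v] is not killed. *)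
pose Phi (w : 'rV[exterior K n]_r) := \sum_i w 0 i * ext_restrict X (g i).
have Phi0 : Phi v = 0.
  (* [Phi] is linear over [E], so it suffices that it vanishes on linear syzygies. *)
  have [s [c [w [lin_w ->]]]] := lin v syz_v.
  rewrite /Phi (eq_bigr (fun i => \sum_(j < s) c j * (w j 0 i * ext_restrict X (g i)))).
    rewrite exchange_big big1 // => j _; rewrite -mulr_sumr.
    have [syz_w hw] := lin_w j.
    by rewrite (linear_syzygy_restrict genJ cover m_gt1 sepX syz_w hw) mulr0.
  move=> i _; rewrite summxE mulr_suml; apply: eq_bigr => j _.
  by rewrite mxE mulrA.
have boundary_sub (D T : {set 'I_n}) : ext_boundary K D T != 0 -> T \subset D.
  by case/ext_boundary_neq0 => i _ ->; apply: subsetDl.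
have rf1 : ext_restrict X f1 = f1.
  apply/ffunP => U; rewrite ffunE; case: ifP => // sU.
  apply/esym/eqP; apply: contraFT sU => /boundary_sub sU.
  exact: subset_trans sU sD1.
have rf2 : ext_restrict X f2 = 0.
  apply/ffunP => U; rewrite ffunE [RHS]ffunE; case: ifP => // sU.
  apply/eqP/negPn/negP => fU; have := hf2 _ fU.
  move/boundary_sub: fU => sU2 eU; have/card_gt0P[z zU] : (0 < #|U|)%N by rewrite eU.
  have := subsetP sD2 z (subsetP sU2 z zU).
  by rewrite inE (subsetP sU).
(* Restriction to [X] fixes [f1] and kills [f2], so only the first half of [Phi v] survives. *)
have : f2 * f1 = 0.
  rewrite -Phi0 /Phi phi -!ext_restrict_sum -ek1 -ek2 rf1 rf2.
  by rewrite mulr0 scaler0 subr0.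
have/card_gt0P[i iD1] : (0 < #|D1|)%N by rewrite eD1.
have/card_gt0P[j jD2] : (0 < #|D2|)%N by rewrite eD2.
have dD : [disjoint D2 & D1].
  by rewrite disjoints_subset; apply: subset_trans sD2 _; rewrite setCS.
(* At this monomial the product has, up to sign, the product of two nonzero boundary
   coefficients. *)
move/ffunP/(_ ((D2 :\ j) :|: (D1 :\ i))); rewrite [RHS]ffunE.
rewrite (extM_disjoint dD (subsetDl _ _) (subsetDl _ _)); [|exact: boundary_sub..].
apply/eqP; rewrite !mulf_eq0 signr_eq0 /=.
by rewrite (negbTE (ext_boundaryD1 K iD1)) (negbTE (ext_boundaryD1 K jD2)).
Qed.
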